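(* Let $C\subset\mathbb{R}^d$ be a convex body and let $\Lambda\subset\mathbb{R}^d$ be a $d$-dimensional lattice. (1) There exists a convex body $K\supset C$ that is lattice complete with respect to $\Lambda$ and satisfies $\mathrm{diam}_\Lambda(K)=\mathrm{diam}_\Lambda(C)$. (2) There exists a convex body $L\subset C$ that is lattice reduced with respect to $\Lambda$ and satisfies $\mathrm{wdt}_\Lambda(L)=\mathrm{wdt}_\Lambda(C)$.
   Context: A convex body is a compact convex set with non-empty interior. A lattice $\Lambda\subset\mathbb{R}^d$ is a discrete subgroup spanning $\mathbb{R}^d$; $\Lambda^\star=\{y: x\cdot y\in\mathbb{Z}\ \forall x\in\Lambda\}$. $\mathrm{wdt}_\Lambda(C)=\min_{y\in\Lambda^\star\setminus\{0\}}\max_{a,b\in C}y\cdot(a-b)$. A segment $[a,b]$ is a lattice segment if $b-a$ is parallel to a nonzero vector of $\Lambda$; its lattice length is $|b-a|/|v|$ where $v$ generates $\Lambda\cap\mathrm{span}\{b-a\}$ and is a positive multiple of $b-a$; $\mathrm{diam}_\Lambda(C)$ is the maximum lattice length of a lattice segment in $C$. $C$ is lattice reduced if no convex body $C'\subsetneq C$ has the same lattice width; lattice complete if no convex body $C'\supsetneq C$ has the same lattice diameter. *)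

(* Defs.v *)
From HB Require Import structures.
From mathcomp Require Import all_boot all_order all_algebra.
From mathcomp Require Import all_classical all_reals all_analysis.
Set Implicit Arguments. Unset Strict Implicit. Unset Printing Implicit Defensive.
Import Order.TTheory GRing.Theory Num.Theory.
Import numFieldNormedType.Exports.
Local Open Scope classical_set_scope.
Local Open Scope ring_scope.

Section Defs.
Context {R : realType} {d : nat}.
Local Notation V := ('rV[R]_d).

Definition dotv (x y : V) : R := \sum_(i < d) x 0 i * y 0 i.

Definition convex_set (C : set V) : Prop :=
  forall x y t, C x -> C y -> 0 <= t <= 1 -> C ((1 - t) *: x + t *: y).

Definition convex_body (C : set V) : Prop :=
  compact C /\ convex_set C /\ (interior C !=set0).

Definition in_span (S : set V) (x : V) : Prop :=
  exists (n : nat) (c : 'I_n -> R) (v : 'I_n -> V),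
    (forall i, S (v i)) /\ x = \sum_(i < n) c i *: v i.

Definition is_lattice (L : set V) : Prop :=
  [/\ L 0, (forall x y, L x -> L y -> L (x - y)),
      (forall x, L x -> exists2 e : R, 0 < e &
          forall y, L y -> `|y - x| < e -> y = x)
    & (forall x, in_span L x)].

Definition dual_lattice (L : set V) : set V :=
  [set y | forall x, L x -> exists z : int, dotv x y = z%:~R].

Definition lat_width (L : set V) (C : set V) : R :=
  inf [set w | exists y, [/\ dual_lattice L y, y != 0 &
         w = sup [set r | exists a b, [/\ C a, C b & r = dotv y (a - b)]]]].

Definition lattice_segment (L : set V) (a b : V) : Prop :=
  exists v t, [/\ L v, v != 0 & b - a = t *: v].

Definition generates_line (L : set V) (v : V) : Prop :=
  [/\ L v, v != 0 & forall w s, L w -> w = s *: v -> exists k : int, s = k%:~R].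

(* lattice length of [a,b]: |b-a|/|v| with v generating L ∩ span{b-a} and a
   positive multiple of b-a (v is then unique; the set below is a singleton,
   or empty when a = b, in which case the length is 0 = sup set0). *)
Definition lat_length (L : set V) (a b : V) : R :=
  sup [set `|b - a| / `|v| | v in
        [set v | generates_line L v /\ exists2 s : R, 0 < s & v = s *: (b - a)]].

Definition lat_diam (L : set V) (C : set V) : R :=
  sup [set l | exists a b, [/\ C a, C b, lattice_segment L a b & l = lat_length L a b]].

Definition lattice_reduced (L : set V) (C : set V) : Prop :=
  convex_body C /\
  ~ (exists C', [/\ convex_body C', C' `<=` C, C' != C & lat_width L C' = lat_width L C]).

Definition lattice_complete (L : set V) (C : set V) : Prop :=
  convex_body C /\
  ~ (exists C', [/\ convex_body C', C `<=` C', C' != C & lat_diam L C' = lat_diam L C]).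

End Defs.

(* Main.v *)
(** Zorn's lemma reduces both parts to chains.  (1) The closure of the union of a
    chain of bodies of lattice diameter D keeps this diameter, since a segment of
    the closure shrinks slightly towards an interior point of C into a member of
    the chain.  It is bounded: by Dirichlet's theorem a body that contains a fixed
    ball and a remote point contains a long lattice segment.  (2) The intersection
    of a chain of bodies of width w has width w by compactness.  Its interior is
    non-empty: otherwise it lies in a hyperplane, and Dirichlet's theorem for the
    dual lattice gives dual vectors nearly normal to the hyperplane, in whose
    direction the width is below w > 0. *)
Require Import Defs.
From HB Require Import structures.
From mathcomp Require Import all_boot all_order all_algebra.
From mathcomp Require Import all_classical all_reals all_analysis.
From mathcomp Require Import ring lra.
Set Implicit Arguments. Unset Strict Implicit. Unset Printing Implicit Defensive.
Import Order.TTheory GRing.Theory Num.Theory.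
Import numFieldNormedType.Exports.
Local Open Scope classical_set_scope.
Local Open Scope ring_scope.

(** * Zorn's lemma on a subset, and the pigeonhole principle *)

Lemma Zorn_on (T : Type) (P : set T) (R : T -> T -> Prop) (t0 : T) :
  P t0 -> (forall t, R t t) -> (forall r s t, R r s -> R s t -> R r t) ->
  (forall F, F `<=` P -> F !=set0 -> total_on F R ->
     exists2 t, P t & forall s, F s -> R s t) ->
  exists2 t, P t & forall s, P s -> R t s -> R s t.
Proof.
move=> Pt0 Rxx Rtr chain.
pose Q (s t : {t | P t}) := `[< R (sval s) (sval t) >].
have [| | |[t Pt] tmax] := @ZL_preorder {t | P t} (exist _ t0 Pt0) Q.
- by move=> t; apply/asboolP.
- by move=> r s t /asboolP rs /asboolP st; apply/asboolP; exact: Rtr st.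
(* The hypothesis covers only non-empty chains; [t0] bounds the empty one. *)
- move=> F Ftot; have [->|/set0P[x0 Fx0]] := eqVneq F set0.
    by exists (exist _ t0 Pt0).
  have [| | |t Pt tF] := chain [set sval x | x in F].
  + by move=> _ [[x Px] _ <-].
  + by exists (sval x0), x0.
  + move=> _ _ [x Fx <-] [y Fy <-].
    by case: (Ftot _ _ Fx Fy) => /asboolP; [left|right].
  + exists (exist _ t Pt) => s Fs; apply/asboolP; apply: tF.
    by exists s.
- exists t => // s Ps ts.
  by have /asboolP := tmax (exist _ s Ps) (introT (asboolP _) ts).
Qed.

(** The #|T| + 1 indices from 0 to #|T| cannot have distinct images. The bound on [j] does not
    depend on [g], which later makes constants uniform. *)
Lemma pigeonhole (T : finType) (g : nat -> T) :
  exists i j, (i < j <= #|T|)%N /\ g i = g j.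
Proof.
apply: contrapT => H.
have inj : injective (fun i : 'I_(#|T|.+1) => g i).
  move=> i j gij; apply/val_inj/eqP; rewrite eqn_leq.
  apply/andP; split; rewrite leqNgt; apply/negP => lt; apply: H.
  - by exists j, i; rewrite lt -ltnS ltn_ord.
  - by exists i, j; rewrite lt -ltnS ltn_ord.
by have := leq_card _ inj; rewrite card_ord ltnn.
Qed.

(** * Estimates for the maximum norm and the dot product; topology in terms of the norm *)

Section Norm.
Context {R : realType}.

Lemma coord_le_norm {m n} (x : 'M[R]_(m, n)) i j : `|x i j| <= `|x|.
Proof.
rewrite [leRHS]/Num.norm /= mx_normrE.
by apply/bigmax_geP; right => /=; exists (i, j).
Qed.

Lemma norm_le_coord {m n} (x : 'M[R]_(m, n)) e :
  0 <= e -> (forall i j, `|x i j| <= e) -> `|x| <= e.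
Proof.
move=> e0 xe; rewrite [leLHS]/Num.norm /= mx_normrE.
by apply/bigmax_leP; split => // -[i j] _; exact: xe.
Qed.

Lemma norm_mulmx_le {m n p} (x : 'M[R]_(m, n)) (A : 'M[R]_(n, p)) :
  `|x *m A| <= n%:R * `|A| * `|x|.
Proof.
apply: norm_le_coord => [|i j]; first by rewrite !mulr_ge0.
rewrite mxE (le_trans (ler_norm_sum _ _ _))//.
apply: (@le_trans _ _ (\sum_(k < n) `|A| * `|x|)).
  apply: ler_sum => k _; rewrite normrM mulrC.
  by apply: ler_pM => //; exact: coord_le_norm.
by rewrite sumr_const card_ord -mulrA mulr_natl.
Qed.

Lemma mulmx_bounded {m n p} (A : 'M[R]_(n, p)) :
  exists2 k : R, 0 < k & forall x : 'M[R]_(m, n), `|x *m A| <= k * `|x|.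
Proof.
exists (n%:R * `|A| + 1) => [|x]; first by rewrite ltr_wpDl// mulr_ge0.
by rewrite (le_trans (norm_mulmx_le _ _))// mulrDl mul1r lerDl.
Qed.

Context {d : nat}.
Implicit Types (x y u : 'rV[R]_d) (C : set 'rV[R]_d).

Lemma dotvE x y : dotv x y = (y *m x^T) 0 0.
Proof. by rewrite mxE; apply: eq_bigr => i _; rewrite mxE mulrC. Qed.

Lemma dotvDl x y u : dotv (x + y) u = dotv x u + dotv y u.
Proof. by rewrite -big_split; apply: eq_bigr => i _; rewrite mxE mulrDl. Qed.

Lemma dotvZl t x u : dotv (t *: x) u = t * dotv x u.
Proof. by rewrite big_distrr; apply: eq_bigr => i _; rewrite mxE /= mulrA. Qed.

Lemma dotvC x y : dotv x y = dotv y x.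
Proof. by apply: eq_bigr => i _; rewrite mulrC. Qed.

Lemma dotvDr x y u : dotv u (x + y) = dotv u x + dotv u y.
Proof. by rewrite dotvC dotvDl !(dotvC u). Qed.

Lemma dotvZr t x u : dotv u (t *: x) = t * dotv u x.
Proof. by rewrite dotvC dotvZl (dotvC u). Qed.

Lemma dotvBr x y u : dotv u (x - y) = dotv u x - dotv u y.
Proof. by rewrite dotvDr -scaleN1r dotvZr mulN1r. Qed.

Lemma dotvBl x y u : dotv (x - y) u = dotv x u - dotv y u.
Proof. by rewrite dotvC dotvBr !(dotvC u). Qed.

Lemma dotvv_eq0 u : dotv u u = 0 -> u = 0.
Proof.
move=> /eqP; rewrite psumr_eq0 => [/allP u0|i _]; last by rewrite -expr2 sqr_ge0.
apply/rowP => i; rewrite mxE; have := u0 i (mem_index_enum i).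
by rewrite mulf_eq0 orbb => /eqP.
Qed.

Lemma norm_dotv x y : `|dotv x y| <= d%:R * `|x| * `|y|.
Proof.
apply: le_trans (ler_norm_sum _ _ _) _.
apply: (@le_trans _ _ (\sum_(k < d) `|x| * `|y|)).
  by apply: ler_sum => k _; rewrite normrM ler_pM// coord_le_norm.
by rewrite sumr_const card_ord -mulrA mulr_natl.
Qed.

Lemma interior_norm C x :
  C° x <-> exists2 e : R, 0 < e & forall y, `|y - x| < e -> C y.
Proof.
split=> [/nbhs_ballP[e e0 eC]|[e e0 eC]].
  by exists e => // y yx; apply: eC; rewrite -ball_normE /ball_ /= distrC.
apply/nbhs_ballP; exists e => // y; rewrite -ball_normE /ball_ /= distrC.
exact: eC.
Qed.

Lemma closure_norm C x :
  closure C x <-> forall e : R, 0 < e -> exists2 y, C y & `|y - x| < e.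
Proof.
split=> [Cx e e0|H B /nbhs_ballP[e e0 eB]].
  have [y [Cy]] := Cx _ (nbhsx_ballx x e e0).
  by rewrite -ball_normE /ball_ /= distrC => ?; exists y.
have [y Cy yx] := H e e0; exists y; split => //; apply: eB.
by rewrite -ball_normE /ball_ /= distrC.
Qed.

Lemma compact_norm_bounded C : compact C ->
  exists2 M : R, 0 < M & forall x, C x -> `|x| <= M.
Proof.
move=> /compact_bounded[M [_ CM]]; exists (`|M| + 1).
  by rewrite ltr_wpDl.
by move=> x; apply: CM; rewrite (le_lt_trans (ler_norm _))// ltrDl.
Qed.

Lemma norm_bounded_compact C M :
  closed C -> (forall x, C x -> `|x| <= M) -> compact C.
Proof.
move=> Ccl CM; apply: bounded_closed_compact => //.
exists M; split; first exact: num_real.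
by move=> r Mr x Cx; exact: le_trans (CM _ Cx) (ltW Mr).
Qed.

Lemma compact_is_closed C : compact C -> closed C.
Proof. by move=> ?; apply: compact_closed => //; exact: norm_hausdorff. Qed.

End Norm.

(** * Linear algebra: a set of vectors contains a basis or lies in a hyperplane *)

Section Rank.
Context {R : realType} {d : nat}.
Implicit Types (S : set 'rV[R]_d).

(** A free family in [S] with the most rows spans [S], since a vector of [S] outside its row space
    could be appended. *)
Lemma maximal_row_free S : exists n, exists A : 'M[R]_(n, d),
  [/\ row_free A, forall i, S (row i A) & forall v, S v -> (v <= A)%MS].
Proof.
pose P n := `[< exists A : 'M[R]_(n, d), row_free A /\ forall i, S (row i A) >].
have P0 : P 0%N.
  by apply/asboolP; exists 0; split; [rewrite /row_free mxrank0|case].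
have Pd n : P n -> (n <= d)%N.
  move=> /asboolP[A [/eqP rA _]]; rewrite -rA; exact: rank_leq_col.
have [n /asboolP[A [Afree AS]] nmax] := ex_maxnP (ex_intro P 0%N P0) Pd.
exists n, A; split => // v Sv; apply: contrapT => /negP vA.
suff : P (n + 1)%N by move=> /nmax; rewrite addn1 ltnn.
apply/asboolP; exists (col_mx A v); split; last first.
  move=> i; rewrite -(splitK i); case: (fintype.split i) => j /=.
    by rewrite rowKu.
  by rewrite rowKd row_id.
rewrite /row_free -addsmxE.
have v0 : v != 0 by apply: contraNneq vA => ->; exact: sub0mx.
have := mxrank_sum_cap A v; rewrite (eqP Afree) rank_rV v0.
(* The intersection with the line of [v] has rank at most 1, and rank 1 would put [v] in the row
   space of [A]. *)
suff -> : \rank (A :&: v)%MS = 0%N by rewrite addn0 => ->.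
apply/eqP; rewrite -leqn0 leqNgt; apply/negP => r0.
have : (v <= A :&: v)%MS.
  have [_ <-] := mxrank_leqif_sup (capmxSr A v).
  by rewrite eqn_leq mxrankS ?capmxSr// rank_rV v0.
by move=> /submx_trans/(_ (capmxSl _ _)); apply/negP.
Qed.

(** A maximal free family has d rows and is invertible, or has fewer, and then some non-zero vector
    is orthogonal to its row space, hence to [S]. *)
Lemma unitmx_or_hyperplane S :
  (exists2 A : 'M[R]_d, A \in unitmx & forall i, S (row i A)) \/
  (exists2 u : 'rV[R]_d, u != 0 & forall v, S v -> dotv u v = 0).
Proof.
have [n [A [Afree AS SA]]] := maximal_row_free S.
have nd : (n <= d)%N by rewrite -(eqP Afree) rank_leq_col.
case: (ltnP n d) => [lt|ge]; last first.
  have dn : n = d by apply/eqP; rewrite eqn_leq nd.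
  left; subst n; exists A => //; by rewrite -row_free_unit.
right; have : kermx A^T != 0.
  by rewrite -mxrank_eq0 mxrank_ker mxrank_tr (eqP Afree) subn_eq0 -ltnNge.
move=> /rowV0Pn[u /sub_kermxP uA u0]; exists u => // v /SA /submxP[c ->].
rewrite dotvE -mulmxA.
have -> : A *m u^T = 0 by rewrite -[A]trmxK -trmx_mul uA trmx0.
by rewrite mulmx0 mxE.
Qed.

End Rank.

(** * Convex combinations, and convex sets with empty interior *)

Section Convex.
Context {R : realType} {d : nat}.
Implicit Types (C K : set 'rV[R]_d) (p x y u : 'rV[R]_d).

(** The missing weight falls on [p]. The induction splits off the last weight b and divides the
    others by 1 - b; if b = 1 they all vanish. *)
Lemma convex_cone_sum C p n (c : 'I_n -> R) (x : 'I_n -> 'rV[R]_d) :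
  Defs.convex_set C -> C p -> (forall i, C (p + x i)) -> (forall i, 0 <= c i) ->
  \sum_i c i <= 1 -> C (p + \sum_i c i *: x i).
Proof.
move=> Ccv Cp; elim: n c x => [|n IHn] c x Cx c0 c1; first by rewrite big_ord0 addr0.
move: c1; rewrite !big_ord_recr /=; set b := c ord_max => c1.
have b0 : 0 <= b by exact: c0.
have [b1|b1] := eqVneq b 1.
  rewrite big1 ?add0r ?b1 ?scale1r// => i _.
  have /eqP : \sum_(i < n) c (widen_ord (leqnSn n) i) = 0.
    by apply/eqP; rewrite eq_le sumr_ge0// andbT; lra.
  rewrite psumr_eq0 // => /allP/(_ i (mem_index_enum i))/eqP ->.
  by rewrite scale0r.
have s0 : 0 <= \sum_(i < n) c (widen_ord (leqnSn n) i) by exact: sumr_ge0.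
have b1' : 0 < 1 - b by rewrite lt_neqAle eq_sym subr_eq0 eq_sym b1 /=; lra.
have := IHn (fun i => c (widen_ord (leqnSn n) i) / (1 - b))
            (fun i => x (widen_ord (leqnSn n) i)).
rewrite -mulr_suml ler_pdivrMr// mul1r => /(_ (fun i => Cx _)) IH.
have {}IH := IH (fun i => divr_ge0 (c0 _) (ltW b1')).
have {}IH : C (p + \sum_(i < n) (c (widen_ord (leqnSn n) i) / (1 - b)) *:
               x (widen_ord (leqnSn n) i)) by apply: IH; lra.
have b01 : 0 <= b <= 1 by lra.
have := Ccv _ _ b IH (Cx ord_max) b01; congr C.
rewrite !scalerDr addrACA -scalerDl subrK scale1r scaler_sumr.
congr (_ + (_ + _)); apply: eq_bigr => i _.
by rewrite scalerA mulrC divfK// gt_eqF.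
Qed.

(** If the differences a - x0 contained a basis, [K] would contain a full-dimensional simplex with
    vertex [x0]. *)
Lemma empty_interior_hyperplane K x0 :
  Defs.convex_set K -> K x0 -> ~ (K° !=set0) ->
  exists2 u, u != 0 & forall a, K a -> dotv u (a - x0) = 0.
Proof.
move=> Kcv Kx0 Kint.
have [[A Au AK]|[u u0 uK]] := unitmx_or_hyperplane [set a - x0 | a in K]; last first.
  by exists u => // a Ka; apply: uK; exists a.
exfalso; apply: Kint.
(* Coefficients within c of c lie in [0, 2c] and add up to at most 2dc <= 1; the summand 1 keeps the
   denominator positive for d = 0. *)
pose c : R := (2 * d%:R + 1)^-1.
have den : 0 < 2 * d%:R + 1 :> R by rewrite ltr_wpDl// mulr_ge0.
have c0 : 0 < c by rewrite invr_gt0.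
have [k k0 kA] := @mulmx_bounded R 1 _ _ (invmx A).
exists (x0 + const_mx c *m A); apply/interior_norm.
exists (c / k) => [|y]; first exact: divr_gt0.
rewrite ltr_pdivlMr// mulrC => yc.
pose a := (y - x0) *m invmx A.
have ac i : `|a 0 i - c| <= c.
  have -> : a 0 i - c = ((y - (x0 + const_mx c *m A)) *m invmx A) 0 i.
    by rewrite opprD addrA mulmxBl mulmxK// !mxE.
  by rewrite (le_trans (coord_le_norm _ _ _))// (le_trans (kA _))// ltW.
have -> : y = x0 + \sum_i a 0 i *: row i A.
  by rewrite -mulmx_sum_row mulmxKV// addrC subrK.
apply: convex_cone_sum => // [i|i|].
- by have [b Kb <-] := AK i; rewrite addrC subrK.
- by have := ac i; rewrite ler_norml => /andP[]; lra.
- apply: (@le_trans _ _ (\sum_(i < d) 2 * c)).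
    by apply: ler_sum => i _; have := ac i; rewrite ler_norml => /andP[]; lra.
  by rewrite sumr_const card_ord -[leLHS]mulr_natr mulrAC ler_pdivrMr//; lra.
Qed.

End Convex.

(** * Fractional parts and the pigeonhole step of Dirichlet's theorem *)

Section Dirichlet.
Context {R : realType}.

Definition frac (x : R) : R := x - (Num.floor x)%:~R.

Lemma frac_ge0 x : 0 <= frac x.
Proof. by rewrite subr_ge0 floor_le. Qed.

Lemma frac_lt1 x : frac x < 1.
Proof. by have := floor_itv x; rewrite /frac intrD => /andP[]; lra. Qed.

(** The unit cube is cut into boxes of side 1/(m+1), and two of the points have fractional parts in
    the same box. *)
Lemma frac_pigeonhole d m (X : nat -> 'rV[R]_d) : exists i j,
  (i < j <= #|{ffun 'I_d -> 'I_m.+1}|)%N /\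
  forall k, `|frac (X i 0 k) - frac (X j 0 k)| < m.+1%:R^-1.
Proof.
(* Since [frac x < 1], the floor is below m + 1 and [inord] never takes its default value. *)
pose b (x : R) : 'I_m.+1 := inord `|Num.floor (m.+1%:R * frac x)|.
have bE x : (b x)%:R <= m.+1%:R * frac x < (b x)%:R + 1.
  have f0 : 0 <= Num.floor (m.+1%:R * frac x) by rewrite floor_ge0 mulr_ge0// frac_ge0.
  have bx : (b x)%:R = (Num.floor (m.+1%:R * frac x))%:~R :> R.
    rewrite /b inordK; first by rewrite -[in RHS](gez0_abs f0).
    rewrite -ltz_nat gez0_abs// floor_lt_int.
    by rewrite -[ltRHS]mulr1 ltr_pM2l ?frac_lt1.
  by have := floor_itv (m.+1%:R * frac x); rewrite bx intrD.
have [i [j [ij bij]]] := pigeonhole (fun i => [ffun k => b (X i 0 k)]).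
exists i, j; split => // k.
have /andP[i1 i2] := bE (X i 0 k); have /andP[j1 j2] := bE (X j 0 k).
have bk : b (X i 0 k) = b (X j 0 k) by move/ffunP: bij => /(_ k); rewrite !ffunE.
rewrite bk in i1 i2.
rewrite -(ltr_pM2l (ltr0Sn R m)) divff// -[X in X * _]ger0_norm// -normrM mulrBr.
by rewrite ltr_norml; apply/andP; split; lra.
Qed.

End Dirichlet.

(** * Lattices, their duals, and approximation of directions *)

Section Lattice.
Context {R : realType} {d : nat}.
Implicit Types (L S : set 'rV[R]_d).

(** The properties shared by a lattice and its dual, so that [subgroup_approx] serves both. *)
Definition subgroup S := S 0 /\ forall x y, S x -> S y -> S (x - y).

Lemma subgroupN S x : subgroup S -> S x -> S (- x).
Proof. by move=> [S0 SB] Sx; rewrite -sub0r; exact: SB. Qed.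

Lemma subgroupD S x y : subgroup S -> S x -> S y -> S (x + y).
Proof.
by move=> Sg Sx Sy; rewrite -[y]opprK; apply: Sg.2 => //; exact: subgroupN.
Qed.

Lemma subgroupMz S x (z : int) : subgroup S -> S x -> S (z%:~R *: x).
Proof.
move=> Sg Sx; have Sn n : S (n%:R *: x).
  elim: n => [|n IHn]; first by rewrite scale0r; exact: Sg.1.
  by rewrite -natr1 scalerDl scale1r; exact: subgroupD.
case: z => n; first exact: Sn.
by rewrite NegzE intrN scaleNr; apply: subgroupN => //; exact: Sn.
Qed.

Lemma subgroup_sum S n (z : 'I_n -> int) (x : 'I_n -> 'rV[R]_d) : subgroup S ->
  (forall i, S (x i)) -> S (\sum_i (z i)%:~R *: x i).
Proof.
move=> Sg Sx; apply: (big_ind S) => [|x1 y1 S1 S2|i _].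
- exact: Sg.1.
- exact: subgroupD.
- exact: subgroupMz.
Qed.

Lemma lattice_subgroup L : is_lattice L -> subgroup L.
Proof. by case. Qed.

Lemma dual_subgroup L : subgroup (dual_lattice L).
Proof.
split=> [x _|x y Dx Dy v Lv].
  by exists 0; rewrite /dotv big1// => i _; rewrite mxE mulr0.
have [a xa] := Dx _ Lv; have [b yb] := Dy _ Lv.
by exists (a - b); rewrite dotvBr xa yb intrB.
Qed.

Lemma lattice_discrete L : is_lattice L ->
  exists2 e : R, 0 < e & forall y, L y -> `|y| < e -> y = 0.
Proof.
move=> [L0 _ /(_ 0 L0)[e e0 eL] _]; exists e => // y Ly ye.
by apply: eL; rewrite ?subr0.
Qed.

(** A vector orthogonal to [L] is itself a combination of vectors of [L], so it is orthogonal to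
    itself. The rows of [A] are a basis of the space; they may generate a proper sublattice of
    [L]. *)
Lemma lattice_basis L : is_lattice L ->
  exists2 A : 'M[R]_d, A \in unitmx & forall i, L (row i A).
Proof.
move=> [_ _ _ Lsp]; have [//|[u u0 uL]] := unitmx_or_hyperplane L.
exfalso; move/eqP: u0; apply; apply: dotvv_eq0.
have [n [c [v [Lv uE]]]] := Lsp u.
rewrite {2}uE dotvE mulmx_suml summxE big1 // => i _.
by rewrite -dotvE dotvZr uL// mulr0.
Qed.

(* The classes of x, 2x, 3x, ... modulo the sublattice spanned by the rows of A
   cannot stay pairwise separated, so a bounded multiple of x lies in it. *)
Lemma lattice_finite_index L (A : 'M[R]_d) : is_lattice L -> A \in unitmx ->
  (forall i, L (row i A)) ->
  exists2 N : nat, (0 < N)%N & forall c : 'rV[R]_d, L (c *m A) ->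
    forall k, exists z : int, N%:R * c 0 k = z%:~R.
Proof.
move=> HL Au LA; have [e e0 eL] := lattice_discrete HL.
have Lg := lattice_subgroup HL.
have [kap kap0 kapA] := @mulmx_bounded R 1 _ _ A.
have [m me] : exists m : nat, kap * m.+1%:R^-1 < e.
  exists (Num.truncn (kap / e)).
  by rewrite ltr_pdivrMr// mulrC -ltr_pdivrMr// truncnS_gt.
(* The factorial is a multiple of every possible j - i, so it works for all [c] at once. *)
exists (#|{ffun 'I_d -> 'I_m.+1}|)`!; first exact: fact_gt0.
move=> c Lc k.
have [i [j [/andP[ij jM] fij]]] := frac_pigeonhole m (fun i => i%:R *: c).
(* [w *m A] is a lattice vector shorter than [e], hence zero; so i c and j c have equal fractional
   parts and (j - i) c is integral. *)
pose w := \row_k (frac ((i%:R *: c) 0 k) - frac ((j%:R *: c) 0 k)).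
have w0 : w *m A = 0.
  apply: eL; last first.
    rewrite (le_lt_trans (kapA _))// (le_lt_trans _ me)// ler_pM2l//.
    by apply: norm_le_coord => [|a b]; rewrite ?invr_ge0// mxE ltW.
  pose z k := Num.floor ((j%:R *: c) 0 k) - Num.floor ((i%:R *: c) 0 k).
  have -> : w *m A = (i%:Z - j%:Z)%:~R *: (c *m A) + \sum_k (z k)%:~R *: row k A.
    have -> : \sum_k (z k)%:~R *: row k A = (\row_k (z k)%:~R) *m A.
      by rewrite mulmx_sum_row; apply: eq_bigr => l _; rewrite mxE.
    rewrite scalemxAl -mulmxDl; congr (_ *m A); apply/rowP => l.
    by rewrite !mxE /frac /z !mxE !intrB; ring.
  apply: subgroupD => //; first exact: subgroupMz.
  exact: subgroup_sum.
have {}w0 : w = 0 by rewrite -[w](mulmxK Au) w0 mul0mx.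
have : w 0 k = 0 by rewrite w0 mxE.
rewrite mxE /frac !mxE => wk.
have ji : (0 < j - i <= #|{ffun 'I_d -> 'I_m.+1}|)%N.
  by rewrite subn_gt0 ij (leq_trans (leq_subr _ _)).
have /dvdnP[q ->] := dvdn_fact ji.
exists (q%:Z * (Num.floor (j%:R * c 0 k) - Num.floor (i%:R * c 0 k))).
rewrite intrM intrB natrM natrB ?(ltnW ij)// -mulrA; congr (_ * _); lra.
Qed.

(** The rows of the inverse transpose of [A] pair with x to the coordinates of x in the basis [A];
    the factor [N] makes these integral on all of [L]. *)
Lemma dual_basis L : is_lattice L ->
  exists2 B : 'M[R]_d, B \in unitmx & forall i, dual_lattice L (row i B).
Proof.
move=> HL; have [A Au LA] := lattice_basis HL.
have [N N0 NA] := lattice_finite_index HL Au LA.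
exists (N%:R *: (invmx A)^T).
  by rewrite unitmxZ ?unitmx_tr ?unitmx_inv// unitfE pnatr_eq0 -lt0n.
move=> i x Lx; have := NA (x *m invmx A); rewrite mulmxKV// => /(_ Lx i)[z zE].
exists z; rewrite -zE /dotv mxE big_distrr; apply: eq_bigr => l _ /=.
by rewrite !mxE; ring.
Qed.

(** Dirichlet's theorem: two multiples of [u] nearly agree modulo the span over the integers of the
    rows of [A], so their difference is close to a vector of [S]. The bound [T] is uniform in
    [u]. *)
Lemma subgroup_approx S (A : 'M[R]_d) (e : R) : subgroup S -> A \in unitmx ->
  (forall i, S (row i A)) -> 0 < e ->
  exists2 T : R, 0 < T & forall u : 'rV[R]_d, `|u| = 1 -> exists v s,
    [/\ S v, v != 0, 0 < s <= T & `|v - s *: u| <= e].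
Proof.
move=> Sg Au SA e0.
have [kap kap0 kapA] := @mulmx_bounded R 1 _ _ A.
have [m me] : exists m : nat, kap * m.+1%:R^-1 < e.
  exists (Num.truncn (kap / e)).
  by rewrite ltr_pdivrMr// mulrC -ltr_pdivrMr// truncnS_gt.
exists (kap * (#|{ffun 'I_d -> 'I_m.+1}|)%:R).
  by rewrite mulr_gt0// ltr0n card_ffun !card_ord expn_gt0.
(* The factor [kap] gives [al] a coordinate of absolute value at least 1. Its multiple by j - i is
   then too large to be approximated by 0, so the vector found is non-zero. *)
move=> u u1; pose al := kap *: (u *m invmx A).
have alA : al *m A = kap *: u by rewrite /al -scalemxAl mulmxKV.
have al1 : 1 <= `|al|.
  by rewrite -(ler_pM2l kap0) (le_trans _ (kapA _))// alA normrZ u1 gtr0_norm.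
have [[i0 l] /= lE] : exists i, `|al| = `|al i.1 i.2|.
  by apply: (@mx_norm_neq0 _ _ _ al); rewrite gt_eqF// (lt_le_trans _ al1).
have al1' : 1 <= `|al 0 l| by rewrite -[0](ord1 i0) -lE.
have [i [j [/andP[ij jM] fij]]] := frac_pigeonhole m (fun i => i%:R *: al).
have ji : (0 < j - i <= #|{ffun 'I_d -> 'I_m.+1}|)%N.
  by rewrite subn_gt0 ij (leq_trans (leq_subr _ _)).
pose z k := Num.floor ((j%:R *: al) 0 k) - Num.floor ((i%:R *: al) 0 k).
pose zz : 'rV[R]_d := \row_k (z k)%:~R.
have zE k : zz 0 k - (j - i)%:R * al 0 k =
    frac ((i%:R *: al) 0 k) - frac ((j%:R *: al) 0 k).
  by rewrite mxE /z intrB /frac natrB ?(ltnW ij)// !mxE; ring.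
exists (zz *m A), (kap * (j - i)%:R); split.
- have -> : zz *m A = \sum_k (z k)%:~R *: row k A.
    by rewrite mulmx_sum_row; apply: eq_bigr => k _; rewrite mxE.
  exact: subgroup_sum.
- apply/eqP => zA; have z0 : zz = 0 by rewrite -[zz](mulmxK Au) zA mul0mx.
  have := fij l; rewrite -zE z0 mxE sub0r normrN normrM ger0_norm//.
  apply/negP; rewrite -leNgt (@le_trans _ _ 1)//.
    by rewrite invf_le1// ler1n.
  rewrite -[leLHS]mulr1 ler_pM//.
  by rewrite ler1n; case/andP: ji.
- by case/andP: ji => ji1 ji2; rewrite mulr_gt0 ?ltr0n// ler_pM2l// ler_nat.
- have -> : zz *m A - (kap * (j - i)%:R) *: u = (zz - (j - i)%:R *: al) *m A.
    by rewrite mulmxBl -[in RHS]scalemxAl alA scalerA [_ * kap]mulrC.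
  rewrite (le_trans (kapA _))// (le_trans _ (ltW me))// ler_pM2l//.
  apply: norm_le_coord => [|a b]; first by rewrite invr_ge0.
  by rewrite (ord1 a) ltW//; have := fij b; rewrite -zE !mxE.
Qed.

End Lattice.

(** * Lattice length, lattice diameter, and chains for completeness *)

Section Diameter.
Context {R : realType} {d : nat}.
Implicit Types (L C K : set 'rV[R]_d) (p x y u g a b : 'rV[R]_d).

(** Discreteness bounds the positive s with s v in [L] away from 0, and a nearly least such s gives
    a generator. *)
Lemma line_generator L v : is_lattice L -> L v -> v != 0 ->
  exists g k, [/\ generates_line L g, 1 <= k & v = k *: g].
Proof.
move=> HL Lv v0; have Lg := lattice_subgroup HL.
have [e e0 eL] := lattice_discrete HL.
have nv : 0 < `|v| by rewrite normr_gt0.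
pose E := [set s : R | 0 < s /\ L (s *: v)].
have E1 : E 1 by split; rewrite ?scale1r.
have Elb : lbound E (e / `|v|).
  move=> s [s0 Ls]; rewrite ler_pdivrMr// leNgt; apply/negP => sv.
  have : s *: v = 0 by apply: eL => //; rewrite normrZ gtr0_norm.
  by move/eqP; rewrite scaler_eq0 gt_eqF//= (negbTE v0).
have infE : 0 < inf E.
  by apply: (@lt_le_trans _ _ (e / `|v|)); rewrite ?divr_gt0// lb_le_inf//; exists 1.
have hE : has_inf E by split; [exists 1|exists (e / `|v|)].
(* Here s < 2 inf E is enough: a coefficient with fractional part f > 0 would put both f s and (1 -
   f) s in [E], although they add up to s. *)
have [s [s0 Ls] slt] := inf_adherent infE hE.
have Eint w t : L w -> w = t *: (s *: v) -> exists k : int, t = k%:~R.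
  move=> Lw wE; exists (Num.floor t); apply/eqP; rewrite -subr_eq0 -/(frac t).
  rewrite eq_le frac_ge0 andbT leNgt; apply/negP => f0.
  have Lf : L ((frac t * s) *: v).
    rewrite /frac mulrBl scalerBl -!scalerA -wE.
    by apply: Lg.2 => //; exact: subgroupMz.
  have E2 : E (frac t * s) by split => //; exact: mulr_gt0.
  have E3 : E ((1 - frac t) * s).
    split; first by rewrite mulr_gt0// subr_gt0 frac_lt1.
    by rewrite mulrBl mul1r scalerBl; exact: Lg.2.
  have := ge_inf hE.2 E2; have := ge_inf hE.2 E3.
  rewrite mulrBl mul1r; lra.
have vE : v = s^-1 *: (s *: v) by rewrite scalerA mulVf ?scale1r// gt_eqF.
exists (s *: v), s^-1; split => //.
  by split => //; rewrite scaler_eq0 gt_eqF.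
have [k kE] := Eint _ _ Lv vE.
by have := s0; rewrite -invr_gt0 kE ltr0z ler1z.
Qed.

(** The generator in a given direction is unique: the ratio of two such generators and its inverse
    are positive integers, hence 1. *)
Lemma lat_length_generator L a b g t :
  generates_line L g -> 0 < t -> b - a = t *: g -> lat_length L a b = t.
Proof.
move=> [Lg g0 gL] t0 ba; rewrite -[RHS]sup1; congr sup.
have ng : 0 < `|g| by rewrite normr_gt0.
rewrite eqEsubset; split => [_ [v [[Lv v0 vL] [s s0 vE]] <-]|_ ->] /=.
  have vg : v = (s * t) *: g by rewrite vE ba scalerA.
  have st0 : 0 < s * t by exact: mulr_gt0.
  have [k kE] := gL _ _ Lv vg.
  have [k' kE'] : exists k : int, (s * t)^-1 = k%:~R.
    by apply: (vL g) => //; rewrite vg scalerA mulVf ?scale1r// gt_eqF.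
  have st1 : s * t = 1.
    have ge1 : 1 <= s * t by move: st0; rewrite kE ltr0z ler1z.
    have : 1 <= (s * t)^-1 by move: st0; rewrite -invr_gt0 kE' ltr0z ler1z.
    by rewrite invf_ge1// => le1; apply/eqP; rewrite eq_le le1.
  by rewrite vg ba st1 scale1r normrZ gtr0_norm// mulfK// gt_eqF.
exists g; last by rewrite ba normrZ gtr0_norm// mulfK// gt_eqF.
split => //; exists t^-1; first by rewrite invr_gt0.
by rewrite ba scalerA mulVf ?scale1r// gt_eqF.
Qed.

Lemma lat_length_cases L a b : lat_length L a b = 0 \/
  exists g t, [/\ generates_line L g, 0 < t, b - a = t *: g & lat_length L a b = t].
Proof.
have [S0|/set0P[v [vgen [s s0 vE]]]] := eqVneq [set v | generates_line L v /\
    exists2 s : R, 0 < s & v = s *: (b - a)] set0.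
  by left; rewrite /lat_length S0 image_set0 sup0.
have ba : b - a = s^-1 *: v by rewrite vE scalerA mulVf ?scale1r// gt_eqF.
right; exists v, s^-1; rewrite invr_gt0; split => //.
by apply: lat_length_generator ba; rewrite ?invr_gt0.
Qed.

Lemma lat_length_ge0 L a b : 0 <= lat_length L a b.
Proof. by have [->//|[g [t [_ t0 _ ->]]]] := lat_length_cases L a b; exact: ltW. Qed.

(** The assumption [0 <= D] takes care of degenerate segments and of the default [sup set0 = 0]. *)
Lemma lat_diam_le L C D : 0 <= D ->
  (forall a b g t, C a -> C b -> generates_line L g -> 0 < t -> b - a = t *: g ->
     t <= D) -> lat_diam L C <= D.
Proof.
move=> D0 H; rewrite /lat_diam; set E := (X in sup X).
have [->|/set0P E0] := eqVneq E set0; first by rewrite sup0.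
apply: ge_sup => // _ [a [b [Ca Cb _ ->]]].
have [->//|[g [t [gL t0 ba ->]]]] := lat_length_cases L a b.
exact: H ba.
Qed.

Lemma lat_diam_ge0 L C : 0 <= lat_diam L C.
Proof.
rewrite /lat_diam; set E := (X in sup X).
have [[[l El] Eub]|nE] := pselect (has_sup E); last by rewrite sup_out.
apply: le_trans (ub_le_sup Eub El); have [a [b [_ _ _ ->]]] := El.
exact: lat_length_ge0.
Qed.

(** Generators have norm at least some e > 0, so lengths in [C] are at most 2M/e and the supremum is
    a true upper bound. *)
Lemma le_lat_diam L C M a b g t : is_lattice L -> (forall x, C x -> `|x| <= M) ->
  C a -> C b -> generates_line L g -> 0 < t -> b - a = t *: g -> t <= lat_diam L C.
Proof.
move=> HL CM Ca Cb gL t0 ba; have [e e0 eL] := lattice_discrete HL.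
apply: ub_le_sup.
  exists (2 * M / e) => _ [a' [b' [Ca' Cb' _ ->]]].
  have M0 : 0 <= M by rewrite (le_trans _ (CM _ Ca)).
  have [->|[g' [t' [[Lg' g'0 _] t'0 ba' ->]]]] := lat_length_cases L a' b'.
    by rewrite !mulr_ge0// invr_ge0 ltW.
  rewrite ler_pdivlMr//; apply: (@le_trans _ _ `|b' - a'|).
    rewrite ba' normrZ gtr0_norm// ler_pM2l// leNgt; apply/negP => /(eL _ Lg')/eqP.
    exact/negP.
  by rewrite (le_trans (ler_normB _ _))//; have := CM _ Ca'; have := CM _ Cb'; lra.
exists a, b; split => //; last by rewrite (lat_length_generator gL t0 ba).
by case: gL => Lg g0 _; exists g, t.
Qed.

Lemma lat_diam_mono L C K M : is_lattice L -> (forall x, K x -> `|x| <= M) ->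
  C `<=` K -> lat_diam L C <= lat_diam L K.
Proof.
move=> HL KM CK; apply: lat_diam_le => [|a b g t Ca Cb]; first exact: lat_diam_ge0.
by apply: (le_lat_diam HL KM); exact: CK.
Qed.

(* By Dirichlet's theorem some lattice vector v is nearly parallel to x - p; if x
   is far from p, the cone over the ball around p with apex x contains the
   segment from p to p + (D + 1) v. *)
Lemma lat_diam_bounded L p r D : is_lattice L -> 0 < r -> 0 <= D ->
  exists T : R, forall K M, Defs.convex_set K -> (forall x, K x -> `|x| <= M) ->
    (forall y, `|y - p| < r -> K y) -> lat_diam L K <= D ->
    forall x, K x -> `|x - p| <= T.
Proof.
move=> HL r0 D0; have [A Au LA] := lattice_basis HL.
pose l := D + 1; have l0 : 0 < l by rewrite ltr_wpDl.
have [|T T0 HT] := @subgroup_approx _ _ L A (r / (4 * l)) (lattice_subgroup HL) Au LA.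
  by rewrite divr_gt0// mulr_gt0.
(* Beyond this distance the weight [th] of the apex [x] is at most 1/2. *)
exists (2 * l * T) => K M Kcv KM pK KD x Kx; rewrite leNgt; apply/negP => far.
have N0 : 0 < `|x - p| by rewrite (le_lt_trans _ far)// !mulr_ge0// ltW.
have [|v [s [Lv v0 /andP[s0 sT] vs]]] := HT (`|x - p|^-1 *: (x - p)).
  by rewrite normrZ gtr0_norm ?invr_gt0// mulVf// gt_eqF.
set u := `|x - p|^-1 *: (x - p) in vs.
pose th := l * s / `|x - p|.
have th0 : 0 <= th by rewrite !mulr_ge0 ?invr_ge0// ltW.
have th2 : th <= 2^-1.
  rewrite ler_pdivrMr// [leRHS]mulrC ler_pdivlMr//.
  apply: (le_trans _ (ltW far)); rewrite mulrC mulrA ler_pM2l//.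
  exact: mulr_gt0.
have th1 : 0 < 1 - th by lra.
(* This point q solves (1 - th) q + th x = p + l v; the tolerance r/(4l) and th <= 1/2 keep it in
   the ball around [p]. *)
have Kq : K (p + (l / (1 - th)) *: (v - s *: u)).
  apply: pK; rewrite addrAC subrr add0r normrZ gtr0_norm ?divr_gt0//.
  apply: (@le_lt_trans _ _ (l / (1 - th) * (r / (4 * l)))).
    by rewrite ler_pM2l// divr_gt0.
  have -> : l / (1 - th) * (r / (4 * l)) = r / (4 * (1 - th)).
    by field; rewrite !gt_eqF.
  by rewrite ltr_pdivrMr ?mulr_gt0// ltr_pMr//; lra.
have th01 : 0 <= th <= 1 by lra.
have := Kcv _ _ _ Kq Kx th01.
have -> : (1 - th) *: (p + (l / (1 - th)) *: (v - s *: u)) + th *: x = p + l *: v.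
  have lsN : `|x - p| - l * s != 0.
    by rewrite gt_eqF// subr_gt0 -[ltRHS]mul1r -ltr_pdivrMr// -subr_gt0.
  apply/rowP => i; rewrite !mxE /th; field.
  by rewrite lsN gt_eqF.
have Kp : K p by apply: pK; rewrite subrr normr0.
(* [v] may be a proper multiple k g of a generator, which only increases the lattice length to l k
   >= D + 1. *)
have [g [k [gL k1 vE]]] := line_generator HL Lv v0 => Kl.
have lk : 0 < l * k by rewrite mulr_gt0// (lt_le_trans _ k1).
have := le_lat_diam HL KM Kp Kl gL lk.
rewrite addrAC subrr add0r {1}vE scalerA => /(_ erefl) /le_trans/(_ KD).
apply/negP; rewrite -ltNge (@lt_le_trans _ _ l)//; first by rewrite ltrDl.
by rewrite ler_peMr// ltW.
Qed.

Lemma closure_convex C : Defs.convex_set C -> Defs.convex_set (closure C).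
Proof.
move=> Ccv x y t /closure_norm Cx /closure_norm Cy t01; apply/closure_norm => e e0.
have e2 : 0 < e / 2 by rewrite divr_gt0.
have [x' Cx' xx'] := Cx _ e2; have [y' Cy' yy'] := Cy _ e2.
exists ((1 - t) *: x' + t *: y'); first exact: Ccv.
rewrite opprD addrACA -!scalerBr (le_lt_trans (ler_normD _ _))//.
case/andP: t01 => t0 t1; have t1' : 0 <= 1 - t by rewrite subr_ge0.
rewrite !normrZ !ger0_norm//.
have := ler_wpM2l t1' (ltW xx'); have := ler_wpM2l t0 (ltW yy'); nra.
Qed.

(* Moving a point of the closure towards the centre p of a ball in C brings it
   into C. *)
Lemma closure_shrink C p r x h : Defs.convex_set C -> 0 < r ->
  (forall y, `|y - p| < r -> C y) -> closure C x -> 0 < h <= 1 ->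
  C ((1 - h) *: x + h *: p).
Proof.
move=> Ccv r0 pC /closure_norm Cx /andP[h0 h1].
have [x' Cx' xx'] := Cx (h * r) (mulr_gt0 h0 r0).
have h1' : 0 <= 1 - h by rewrite subr_ge0.
(* Mixed with [x'] in the weights h and 1 - h, this point cancels the error x - x' exactly. *)
have Cp' : C (p + ((1 - h) / h) *: (x - x')).
  apply: pC; rewrite addrAC subrr add0r normrZ ger0_norm ?divr_ge0// ?(ltW h0)//.
  rewrite mulrAC ltr_pdivrMr// distrC; apply: le_lt_trans (_ : _ <= `|x' - x|) _.
    by rewrite ler_piMl//; lra.
  by rewrite mulrC.
have h01 : 0 <= h <= 1 by rewrite h1 ltW.
have := Ccv _ _ _ Cx' Cp' h01; congr C.
rewrite [h *: (p + _)]scalerDr scalerA mulrC divfK ?gt_eqF//.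
by apply/rowP => i; rewrite !mxE; ring.
Qed.

Lemma closure_norm_le C M : (forall x, C x -> `|x| <= M) ->
  forall x, closure C x -> `|x| <= M.
Proof.
move=> CM x /closure_norm Cx; apply/ler_addgt0Pr => e e0.
have [y Cy yx] := Cx e e0; have := CM _ Cy.
have := ler_normB y (y - x); rewrite opprB addrC subrK; lra.
Qed.

Lemma bigcup_chain_convex (F : set (set 'rV[R]_d)) : total_on F subset ->
  (forall K, F K -> Defs.convex_set K) ->
  Defs.convex_set (\bigcup_(K in F) K).
Proof.
move=> Ftot Fcv x y t [K FK Kx] [K' FK' K'y] t01.
have [KK'|K'K] := Ftot _ _ FK FK'.
  by exists K' => //; apply: Fcv => //; exact: KK'.
by exists K => //; apply: Fcv => //; exact: K'K.
Qed.

Lemma complete_chain L C (F : set (set 'rV[R]_d)) : is_lattice L -> convex_body C ->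
  F !=set0 -> total_on F subset ->
  (forall K, F K -> [/\ convex_body K, C `<=` K & lat_diam L K = lat_diam L C]) ->
  let K := closure (\bigcup_(K in F) K) in
  [/\ convex_body K, C `<=` K & lat_diam L K = lat_diam L C].
Proof.
move=> HL [Cco [Ccv [p /interior_norm[r r0 pC]]]] [K0 FK0] Ftot HF.
set U := \bigcup_(K in F) K => K.
have D0 : 0 <= lat_diam L C := lat_diam_ge0 L C.
(* All members of the chain contain the same ball around [p] and have the same diameter, so one [T]
   bounds them all. *)
have [T HT] := lat_diam_bounded p HL r0 D0.
have CU : C `<=` U by move=> x Cx; exists K0 => //; have [_ + _] := HF _ FK0; apply.
have Ucv : Defs.convex_set U.
  by apply: bigcup_chain_convex => // K' /HF[[_ []]].
have UM x : U x -> `|x| <= T + `|p|.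
  move=> [K' FK' K'x]; have [[K'co [K'cv _]] CK' K'D] := HF _ FK'.
  have [M M0 K'M] := compact_norm_bounded K'co.
  have : `|x - p| <= T by apply: (HT K' M) => //; [move=> y /pC/CK'|rewrite K'D].
  have := ler_normD (x - p) p; rewrite subrK; lra.
have UK : U `<=` K by exact: subset_closure.
have KM : forall x, K x -> `|x| <= T + `|p| := closure_norm_le UM.
have CK : C `<=` K by exact: subset_trans UK.
have Kcv : Defs.convex_set K by exact: closure_convex.
split => //.
  split; first by apply: norm_bounded_compact KM; exact: closed_closure.
  split => //; exists p; apply/interior_norm; exists r => // y /pC; exact: CK.
apply/eqP; rewrite eq_le (lat_diam_mono HL KM CK) andbT.
apply: lat_diam_le => // a b g t Ka Kb gL t0 ba; rewrite leNgt; apply/negP => Dt.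
(* With this h the shrunk segment has length (1 - h) t = (t + D)/2, still above D. *)
pose D := lat_diam L C; pose h := (t - D) / (2 * t).
have hE : h * (2 * t) = t - D by rewrite divfK// gt_eqF// mulr_gt0.
have h01 : 0 < h <= 1.
  rewrite divr_gt0 ?subr_gt0 ?mulr_gt0//= ler_pdivrMr ?mulr_gt0//.
  by move: D0; rewrite -/D; lra.
have pU y : `|y - p| < r -> U y by move=> /pC/CU.
have [Ka' FKa' a'K] := closure_shrink Ucv r0 pU Ka h01.
have [Kb' FKb' b'K] := closure_shrink Ucv r0 pU Kb h01.
have [K' [FK' a'K' b'K']] : exists K', [/\ F K',
    K' ((1 - h) *: a + h *: p) & K' ((1 - h) *: b + h *: p)].
  have [ab|ba'] := Ftot _ _ FKa' FKb'.
  - by exists Kb'; split => //; exact: ab.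
  - by exists Ka'; split => //; exact: ba'.
have [[K'co _] _ K'D] := HF _ FK'; have [M M0 K'M] := compact_norm_bounded K'co.
have t'0 : 0 < (1 - h) * t by move: D0; rewrite -/D; nra.
have := le_lat_diam HL K'M a'K' b'K' gL t'0.
rewrite opprD addrACA subrr addr0 -scalerBr ba scalerA => /(_ erefl).
rewrite K'D -/D; move: Dt; rewrite -/D; nra.
Qed.

End Diameter.

(** * Non-emptiness of convex bodies and of intersections of compact chains *)

Lemma convex_body_nonempty (R : realType) d (C : set 'rV[R]_d) :
  convex_body C -> C !=set0.
Proof.
move=> [_ [_ [p /interior_norm[r r0 pC]]]]; exists p; apply: pC.
by rewrite subrr normr0.
Qed.

(** The chain generates a proper filter; a cluster point of it lies in each closed member. *)
Lemma compact_chain_bigcap (T : topologicalType) (I : Type) (G : set I)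
    (S : I -> set T) : G !=set0 ->
  (forall i j, G i -> G j -> S i `<=` S j \/ S j `<=` S i) ->
  (forall i, G i -> [/\ compact (S i), closed (S i) & S i !=set0]) ->
  \bigcap_(i in G) S i !=set0.
Proof.
move=> [i0 Gi0] Stot HS.
have FF : ProperFilter (filter_from G S).
  apply: filter_from_proper => [|i /HS[]//].
  apply: filter_from_filter => [|i j Gi Gj]; first by exists i0.
  by have [ij|ji] := Stot i j Gi Gj; [exists i|exists j] => // x Sx; split => //; auto.
have [Sco _ _] := HS _ Gi0.
have [|x [_ Fx]] := Sco (filter_from G S) FF; first by exists i0.
exists x => i Gi; have [_ Scl _] := HS _ Gi; apply: Scl => B xB.
by apply: Fx => //; exists i.
Qed.

(** * Lattice width and chains for reducedness *)

Section Width.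
Context {R : realType} {d : nat}.
Implicit Types (L C K : set 'rV[R]_d) (p x y u g a b : 'rV[R]_d).

Lemma dotv_continuous y : continuous (dotv y).
Proof.
rewrite /dotv; apply: continuous_big => [|i _ x]; first exact: add_continuous.
apply: (continuous_comp (f := fun z : 'rV[R]_d => z 0 i) (g := *%R (y 0 i))).
  exact: coord_continuous.
exact: mulrl_continuous.
Qed.

(** The inner set of [lat_width], so that [dir_width] is convertible with the supremum there. *)
Definition dir_diffs y C := [set r | exists a b, [/\ C a, C b & r = dotv y (a - b)]].

Definition dir_width y C := sup (dir_diffs y C).

Lemma dir_diffs_has_sup y C M : C !=set0 -> (forall x, C x -> `|x| <= M) ->
  has_sup (dir_diffs y C).
Proof.
move=> [a Ca] CM; split; first by exists (dotv y (a - a)), a, a.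
exists (d%:R * `|y| * (M + M)) => _ [a' [b [Ca' Cb ->]]].
rewrite (le_trans (ler_norm _))// (le_trans (norm_dotv _ _))// ler_wpM2l ?mulr_ge0//.
by rewrite (le_trans (ler_normB _ _))// lerD// CM.
Qed.

Lemma le_dir_width y C M a b : (forall x, C x -> `|x| <= M) -> C a -> C b ->
  dotv y (a - b) <= dir_width y C.
Proof.
move=> CM Ca Cb; apply: ub_le_sup; last by exists a, b.
by have [] := @dir_diffs_has_sup y C M (ex_intro _ a Ca) CM.
Qed.

Lemma dir_width_attained y C M e : C !=set0 -> (forall x, C x -> `|x| <= M) ->
  0 < e -> exists a b, [/\ C a, C b & dir_width y C - e < dotv y (a - b)].
Proof.
move=> C0 CM e0.
have [_ [a [b [Ca Cb ->]]] ab] := sup_adherent e0 (dir_diffs_has_sup y C0 CM).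
by exists a, b.
Qed.

Lemma dir_width_mono y C K M : C !=set0 -> (forall x, K x -> `|x| <= M) ->
  C `<=` K -> dir_width y C <= dir_width y K.
Proof.
move=> [a Ca] KM CK; apply: ge_sup; first by exists (dotv y (a - a)), a, a.
by move=> _ [a' [b [Ca' Cb ->]]]; apply: (le_dir_width _ KM); exact: CK.
Qed.

Lemma lat_width_le_dir L C M y : C !=set0 -> (forall x, C x -> `|x| <= M) ->
  dual_lattice L y -> y != 0 -> lat_width L C <= dir_width y C.
Proof.
move=> [a Ca] CM Dy y0; apply: ge_inf; last by exists y.
exists 0 => _ [y' [_ _ ->]].
by have := le_dir_width y' CM Ca Ca; rewrite dotvBr subrr.
Qed.

(** The witness [y0] makes the set of widths non-empty, so that [inf] does not take its default
    value 0. *)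
Lemma le_lat_width L C w y0 : dual_lattice L y0 -> y0 != 0 ->
  (forall y, dual_lattice L y -> y != 0 -> w <= dir_width y C) ->
  w <= lat_width L C.
Proof.
move=> Dy0 y00 H; apply: lb_le_inf; first by exists (dir_width y0 C), y0.
by move=> _ [y [Dy yn0 ->]]; exact: H.
Qed.

Lemma lat_width_mono L C K M y0 : dual_lattice L y0 -> y0 != 0 ->
  C !=set0 -> (forall x, K x -> `|x| <= M) ->
  C `<=` K -> lat_width L C <= lat_width L K.
Proof.
move=> Dy0 y00 C0 KM CK; apply: (le_lat_width Dy0 y00) => y Dy yn0.
have CM x : C x -> `|x| <= M by move=> /CK/KM.
exact: le_trans (lat_width_le_dir C0 CM Dy yn0) (dir_width_mono y C0 KM CK).
Qed.

(* A nonzero dual vector takes a nonzero integer value on some vector of a fixed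
   basis of L, so its width on a ball is bounded below. *)
Lemma lat_width_gt0 L C y0 : is_lattice L -> convex_body C ->
  dual_lattice L y0 -> y0 != 0 -> 0 < lat_width L C.
Proof.
move=> HL [Cco [_ [p /interior_norm[r r0 pC]]]] Dy0 y00.
have [M _ CM] := compact_norm_bounded Cco.
have [A Au LA] := lattice_basis HL.
(* Every row of [A] scaled by h is shorter than r. *)
pose h := r / (`|A| + 1).
have A1 : 0 < `|A| + 1 by rewrite ltr_wpDl.
have h0 : 0 < h by rewrite divr_gt0.
apply: (lt_le_trans h0); apply: (le_lat_width Dy0 y00) => y Dy yn0.
have [i yi] : exists i, dotv (row i A) y != 0.
  apply: contrapT => Hn; move/eqP: yn0; apply.
  have : A *m y^T = 0.
    apply/colP => i; rewrite [RHS]mxE; apply: contrapT => /eqP Ai; apply: Hn; exists i.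
    suff -> : dotv (row i A) y = (A *m y^T) i 0 by [].
    by rewrite dotvC dotvE -row_mul mxE.
  move=> /(congr1 (mulmx (invmx A))); rewrite mulKmx// mulmx0.
  by move=> /(congr1 trmx); rewrite trmxK trmx0.
have [z zE] := Dy _ (LA i).
have z1 : 1 <= `|dotv (row i A) y|.
  by move: yi; rewrite zE -intr_norm ler1z intr_eq0 -normr_gt0.
pose v := h *: row i A.
have vr : `|v| < r.
  rewrite normrZ gtr0_norm// /h mulrAC ltr_pdivrMr// ltr_pM2l//.
  rewrite (@le_lt_trans _ _ `|A|) ?ltrDl//.
  by apply: norm_le_coord => // k l; rewrite mxE coord_le_norm.
have Cp : C p by apply: pC; rewrite subrr normr0.
have Cpv : C (p + v) by apply: pC; rewrite addrAC subrr add0r.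
have vE : dotv y v = h * dotv (row i A) y by rewrite dotvZr dotvC.
(* The sign of [dotv y v] is unknown, hence the two orientations of the segment from p to p + v
   below. *)
have yv : h <= `|dotv y v| by rewrite vE normrM gtr0_norm// ler_peMr// ltW.
have w1 := le_dir_width y CM Cpv Cp; have w2 := le_dir_width y CM Cp Cpv.
rewrite addrAC subrr add0r in w1; rewrite opprD addrA subrr add0r in w2.
have {}w2 : - dotv y v <= dir_width y C by rewrite -mulN1r -dotvZr scaleN1r.
by apply: le_trans yv _; rewrite ler_norml; apply/andP; split; lra.
Qed.

Lemma reduced_chain L C (F : set (set 'rV[R]_d)) y0 : is_lattice L -> convex_body C ->
  dual_lattice L y0 -> y0 != 0 ->
  F !=set0 -> total_on F subset ->
  (forall K, F K -> [/\ convex_body K, K `<=` C & lat_width L K = lat_width L C]) ->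
  let K := \bigcap_(K in F) K in
  [/\ convex_body K, K `<=` C & lat_width L K = lat_width L C].
Proof.
move=> HL HC Dy0 y00 [K0 FK0] Ftot HF K.
set w := lat_width L C; have w0 : 0 < w := lat_width_gt0 HL HC Dy0 y00.
have [Cco [Ccv _]] := HC; have [M M0 CM] := compact_norm_bounded Cco.
have KC : K `<=` C by move=> x Kx; have [_ + _] := HF _ FK0; apply; exact: Kx.
have KM x : K x -> `|x| <= M by move=> /KC/CM.
have Kcv : Defs.convex_set K.
  move=> x y t Kx Ky t01 A FA; have [[_ [Acv _]] _ _] := HF _ FA.
  by apply: Acv => //; [exact: Kx|exact: Ky].
have Kcl : closed K.
  by apply: closed_bigI => A /HF[[Aco _] _ _]; exact: compact_is_closed.
have Kco : compact K by exact: norm_bounded_compact KM.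
(* The pairs in A x A whose difference has [y]-value at least w - e form a chain of non-empty
   compact sets as A runs through [F]; a common pair lies in [K]. *)
have wide y e : dual_lattice L y -> y != 0 -> 0 < e ->
    exists a b, [/\ K a, K b & w - e <= dotv y (a - b)].
  move=> Dy yn0 e0.
  pose f (z : 'rV[R]_d * 'rV[R]_d) := dotv y z.1 - dotv y z.2.
  pose S A := (A `*` A) `&` [set z | w - e <= f z].
  have Scl : closed [set z | w - e <= f z].
    apply: (@preimage_closed _ _ f [set x | w - e <= x]); last exact: closed_ge.
    move=> z _; apply: cvgB.
      by apply: (cvg_comp fst (dotv y)); [exact: cvg_fst|exact: dotv_continuous].
    by apply: (cvg_comp snd (dotv y)); [exact: cvg_snd|exact: dotv_continuous].
  have Smono A B : A `<=` B -> S A `<=` S B.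
    by move=> AB z [[z1 z2] zw]; split => //; split; exact: AB.
  have [|A B FA FB|A FA|[a b] ab] := @compact_chain_bigcap _ _ F S.
  - by exists K0.
  - by have [AB|BA] := Ftot _ _ FA FB; [left|right]; exact: Smono.
  - have [Acb AC Aw] := HF _ FA; have Aco := Acb.1.
    have A0 : A !=set0 by exact: convex_body_nonempty.
    have AM x : A x -> `|x| <= M by move=> /AC/CM.
    have Axco : compact (A `*` A) by exact: compact_setX.
    have Axcl : closed (A `*` A).
      by apply: compact_closed => //; exact: norm_hausdorff.
    split; first by apply: (subclosed_compact _ Axco); [exact: closedI|exact: subIsetl].
      exact: closedI.
    have [a [b [Aa Ab ab]]] := dir_width_attained y A0 AM e0.
    exists (a, b); split => //=; rewrite /f -dotvBr (le_trans _ (ltW ab))//.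
    rewrite lerD2r /w -Aw; exact: lat_width_le_dir AM Dy yn0.
  - exists a, b; split => [A /ab[[]]//|A /ab[[]]//|].
    by have [_] := ab _ FK0; rewrite dotvBr.
have K0' : K !=set0 by have [a [b [Ka _ _]]] := wide _ _ Dy0 y00 w0; exists a.
split => //; last first.
  apply/eqP; rewrite eq_le (lat_width_mono Dy0 y00 K0' CM KC)/=.
  apply: (le_lat_width Dy0 y00) => y Dy yn0; apply/ler_addgt0Pr => e e0.
  have [a [b [Ka Kb ab]]] := wide _ _ Dy yn0 e0.
  by have := le_dir_width y KM Ka Kb; lra.
split => //; split => //; apply: contrapT => Kint.
have [x0 Kx0] := K0'.
have [u u0 uK] := empty_interior_hyperplane Kcv Kx0 Kint.
have [B Bu DB] := dual_basis HL.
(* Since [u] vanishes on differences of points of [K], this e gives [K] width at most w/2 along [v],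
   whereas [wide] yields a pair with value at least 3w/4. *)
pose e := w / (4 * (d%:R + 1) * M).
have d1 : 0 < d%:R + 1 :> R by rewrite ltr_wpDl.
have e0 : 0 < e by rewrite divr_gt0// !mulr_gt0.
have [T _ HT] := subgroup_approx (dual_subgroup L) Bu DB e0.
have nu : 0 < `|u| by rewrite normr_gt0.
have [|v [s [Dv v0 _ vs]]] := HT (`|u|^-1 *: u).
  by rewrite normrZ gtr0_norm ?invr_gt0// mulVf// gt_eqF.
have w2 : 0 < w / 2 by rewrite divr_gt0.
have [a [b [Ka Kb ab]]] := wide _ _ Dv v0 (divr_gt0 w0 (ltr0n R 4)).
have uab : dotv u (a - b) = 0.
  have := uK _ Ka; have := uK _ Kb; rewrite !dotvBr; lra.
have : `|dotv (v - s *: (`|u|^-1 *: u)) (a - b)| <= (d%:R + 1) * e * (2 * M).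
  apply: (le_trans (norm_dotv _ _)); apply: ler_pM; rewrite ?mulr_ge0//.
    by apply: ler_pM => //; rewrite lerDl.
  by rewrite (le_trans (ler_normB _ _))//; have := KM _ Ka; have := KM _ Kb; lra.
rewrite dotvBl !dotvZl uab !mulr0 subr0.
have -> : (d%:R + 1) * e * (2 * M) = w / 2.
  by rewrite /e; field; rewrite !gt_eqF.
have := ler_norm (dotv v (a - b)); lra.
Qed.

End Width.

(** * Dimension 0 and the two applications of Zorn's lemma *)

Lemma rV0_set_eq (R : realType) (C C' : set 'rV[R]_0) : C !=set0 -> C' !=set0 -> C = C'.
Proof.
move=> [a Ca] [b C'b]; rewrite eqEsubset.
by split => x _; [rewrite (thinmx0 x) -(thinmx0 b)|rewrite (thinmx0 x) -(thinmx0 a)].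
Qed.

Theorem theorem3p20 (R : realType) (d : nat) (L : set 'rV[R]_d) (C : set 'rV[R]_d) :
  is_lattice L -> convex_body C ->
  (exists K, [/\ convex_body K, C `<=` K, lattice_complete L K &
                 lat_diam L K = lat_diam L C]) /\
  (exists L', [/\ convex_body L', L' `<=` C, lattice_reduced L L' &
                 lat_width L L' = lat_width L C]).
Proof.
move=> HL HC; split.
  have [|||F FP F0 Ftot|K [Kb CK Kd] Kmax] := @Zorn_on _
    [set K | [/\ convex_body K, C `<=` K & lat_diam L K = lat_diam L C]] subset C.
  - by split.
  - by move=> ?.
  - by move=> ? ? ?; exact: subset_trans.
  - exists (closure (\bigcup_(K in F) K)).
      exact: complete_chain.
    by move=> K FK x Kx; apply: subset_closure; exists K.
  (* A larger body with the same diameter still competes in the Zorn argument, so it equals [K]. *)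
  - exists K; split => //; split => // -[C' [C'b KC' C'K C'd]]; move/eqP: C'K; apply.
    apply/seteqP; split => //; apply: Kmax => //=; split => //; last by rewrite C'd.
    exact: subset_trans KC'.
(* In dimension 0 there is no non-zero dual vector for [reduced_chain], but [C] is the only convex
   body. Otherwise row 0 of a dual basis is such a vector. *)
case: d L C HL HC => [|d] L C HL HC.
  exists C; split => //; split => // -[C' [C'b _ C'C _]].
  move/eqP: C'C; apply.
  by apply: rV0_set_eq; exact: convex_body_nonempty.
have [B Bu DB] := dual_basis HL.
have B0 : row 0 B != 0.
  apply/eqP => B0; have := congr1 (row 0) (mulmxV Bu).
  rewrite row_mul B0 mul0mx => /rowP/(_ 0); rewrite !mxE eqxx => /eqP.
  by rewrite eq_sym oner_eq0.
(* The order is reverse inclusion, so a maximal element is a minimal body. *)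
have [|||F FP F0 Ftot|K [Kb KC Kw] Kmin] := @Zorn_on _
  [set K | [/\ convex_body K, K `<=` C & lat_width L K = lat_width L C]]
  (fun A B => B `<=` A) C.
- by split.
- by move=> ?.
- by move=> ? ? ? sr ts; exact: subset_trans sr.
- exists (\bigcap_(K in F) K); last by move=> K FK x; apply.
  apply: (reduced_chain HL HC (DB 0) B0) => // A A' FA FA'.
  by have [|] := Ftot _ _ FA FA'; [right|left].
- exists K; split => //; split => // -[C' [C'b C'K C'neq C'w]]; move/eqP: C'neq; apply.
  apply/seteqP; split => //; apply: Kmin => //=; split => //; last by rewrite C'w.
  exact: subset_trans KC.
Qed.
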